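(* Let $M=(M_p)_{p\in\mathbb{N}},N=(N_p)_{p\in\mathbb{N}}\in\mathcal{LC}$ be given, let $\omega_M,\omega_N$ be the corresponding associated weight functions, and put $m_p:=M_p/p!$, $n_p:=N_p/p!$. Then the following are equivalent: (i) $\exists\,A\ge 1\;\exists\,B\ge 1\;\exists\,C\ge 1\;\forall\,\lambda\ge 1\;\exists\,D\ge 1\;\forall\,t\ge 0:\quad \omega_N(\lambda Ct)\le B\lambda\,\omega_M(At)+D\lambda.$ (ii) $\exists\,C\in\mathbb{N}_{>0}\;\exists\,B\ge 1\;\forall\,\lambda\in\mathbb{N}_{>0}\;\exists\,D\ge 1\;\forall\,p\in\mathbb{N}_{>0}:\quad \lambda\,(M_p)^{1/p}\le B D^{1/p}\,(N_{\lambda Cp})^{1/(\lambda Cp)}.$ (iii) $\exists\,C\in\mathbb{N}_{>0}\;\exists\,A\ge 1\;\forall\,\lambda\in\mathbb{N}_{>0}\;\exists\,D\ge 1\;\forall\,p\in\mathbb{N}_{>0}:\quad (m_p)^{1/p}\le A D^{1/p}\,(n_{\lambda Cp})^{1/(\lambda Cp)}.$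
   Context: Notation: $\mathbb{N}=\{0,1,2,\dots\}$, $\mathbb{N}_{>0}=\{1,2,3,\dots\}$. $\mathcal{LC}$ denotes the set of all sequences $M=(M_p)_{p\in\mathbb{N}}$ of positive reals that are normalized ($1=M_0\le M_1$), log-convex ($M_p^2\le M_{p-1}M_{p+1}$ for all $p\ge 1$) and satisfy $\lim_{p\to+\infty}(M_p)^{1/p}=+\infty$. The associated weight function of $M$ is $\omega_M:[0,+\infty)\to[0,+\infty)$, $\omega_M(t):=\sup_{p\in\mathbb{N}}\log\left(\frac{t^p}{M_p}\right)$ for $t>0$, $\omega_M(0):=0$. *)

(* Defs.v *)
From HB Require Import structures.
From mathcomp Require Import all_boot all_order all_algebra.
From mathcomp Require Import all_classical all_reals all_analysis.

Set Implicit Arguments.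
Unset Strict Implicit.
Unset Printing Implicit Defensive.

Import Order.TTheory GRing.Theory Num.Theory.
Import numFieldNormedType.Exports.

Local Open Scope classical_set_scope.
Local Open Scope ring_scope.

(* At p = 0 the exponent is 0^-1 = 0, which does not affect the limit. *)
Definition LC (R : realType) : set (nat -> R) := [set M |
  [/\ forall p, 0 < M p,
      M 0%N = 1 /\ 1 <= M 1%N,
      forall p, (1 <= p)%N -> M p ^+ 2 <= M p.-1 * M p.+1 &
      (M p `^ (p%:R^-1)) @[p --> \oo] --> +oo]].

(* A total function on R; only the values at t >= 0 are meaningful. The real
   supremum is the true one when M is in LC, see has_sup_omega. *)
Definition omega (R : realType) (M : nat -> R) (t : R) : R :=
  if 0 < t then sup (range (fun p : nat => ln (t ^+ p / M p))) else 0.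

Lemma has_sup_omega (R : realType) (M : nat -> R) (t : R) :
  LC M -> 0 < t -> has_sup (range (fun p : nat => ln (t ^+ p / M p))).
Proof.
move=> [M0 _ _ /cvgryPge /(_ t) [n _ Mn]] t0; split.
  by exists (ln (t ^+ 0 / M 0%N)), 0%N.
exists (\sum_(p < n.+1) `|ln (t ^+ p / M p)|) => _ [p _ <-].
have [pn|np] := ltnP p n.+1.
  rewrite (bigD1 (Ordinal pn)) //=.
  by rewrite (le_trans (ler_norm _))// lerDl sumr_ge0.
apply: (@le_trans _ _ 0); last by rewrite sumr_ge0.
apply: ln_le0; rewrite ler_pdivrMr ?mul1r//.
have p0 : (0 < p)%N by exact: leq_trans np.
have := Mn p (ltnW np) => /= tM.
rewrite (le_trans (lerXn2r p _ _ tM)) ?nnegrE ?powR_ge0 ?(ltW t0)//.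
by rewrite -powR_mulrn ?powR_ge0// -powRrM mulVf ?pnatr_eq0 -?lt0n// powRr1 // ltW.
Qed.

(* Main.v *)
(* Raised to the power [k * p] with [k = l * C], condition (ii) reads
   [l ^ (k p) M_p ^ k <= B ^ (k p) D ^ k N_(k p)].  Condition (iii) is the same
   up to constants, since [p! <= p ^ p <= e ^ p p!].  From (i) one gets (ii) by
   evaluating at a point where the supremum defining [omega M] is attained at
   index [p] (a quotient [M_(p+1) / M_p], by log-convexity) and bounding
   [omega N] below by its term of index [k p].  Conversely (ii) bounds the terms
   of [omega N] of index divisible by [k], and the other ones follow from the
   monotonicity of [N]. *)

Require Import Defs.
From HB Require Import structures.
From mathcomp Require Import all_boot all_order all_algebra.
From mathcomp Require Import all_classical all_reals all_analysis.
From mathcomp Require Import lra zify.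

Set Implicit Arguments.
Unset Strict Implicit.
Unset Printing Implicit Defensive.

Import Order.TTheory GRing.Theory Num.Theory.
Import numFieldNormedType.Exports.

Local Open Scope classical_set_scope.
Local Open Scope ring_scope.

Section weight_sequences.
Variable R : realType.
Implicit Types (M N : nat -> R) (s t x : R) (p q k l : nat).

(** * Quotients and monotonicity of log-convex sequences *)

Lemma LC_gt0 M p : LC M -> 0 < M p.
Proof. by case. Qed.

Lemma LC_quotient_gt0 M p : LC M -> 0 < M p.+1 / M p.
Proof. by move=> hM; rewrite divr_gt0 ?(LC_gt0 _ hM). Qed.

Lemma LC_quotient_nondecreasing M : LC M ->
  {homo (fun p => M p.+1 / M p) : p q / (p <= q)%N >-> p <= q}.
Proof.
move=> hM; apply: homo_leq => [x|y x z|p]; [exact: lexx|exact: le_trans|].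
have [_ _ /(_ p.+1 isT) /= M2 _] := hM.
by rewrite ler_pdivrMr ?(LC_gt0 _ hM)// mulrAC ler_pdivlMr ?(LC_gt0 _ hM)// mulrC -expr2 mulrC.
Qed.

Lemma LC_nondecreasing M : LC M -> {homo M : p q / (p <= q)%N >-> p <= q}.
Proof.
move=> hM; apply: homo_leq => [x|y x z|p]; [exact: lexx|exact: le_trans|].
have [_ [M0 M1] _ _] := hM.
rewrite -[leLHS]mul1r -ler_pdivlMr ?(LC_gt0 _ hM)//.
apply: le_trans (LC_quotient_nondecreasing hM (leq0n p)).
by rewrite M0 divr1.
Qed.

Lemma LC_ge1 M p : LC M -> 1 <= M p.
Proof. by move=> hM; have [_ [<- _] _ _] := hM; exact: LC_nondecreasing. Qed.

(* The quotient [M p.+1 / M p] maximizes [t ^+ p / M p]: the terms increase as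
   long as the quotients stay below it and decrease afterwards. *)
Lemma LC_quotient_max M p k : LC M ->
  (M p.+1 / M p) ^+ k / M k <= (M p.+1 / M p) ^+ p / M p.
Proof.
move=> hM; set t := _ / M p in |- *; have t0 : 0 < t by exact: LC_quotient_gt0.
rewrite ler_pdivrMr ?(LC_gt0 _ hM)// mulrAC ler_pdivlMr ?(LC_gt0 _ hM)//.
have up d : (k + d <= p)%N -> M (k + d)%N <= t ^+ d * M k.
  elim: d => [|d IH] kd; first by rewrite addn0 mul1r.
  rewrite addnS exprS -mulrA; apply: le_trans (ler_wpM2l (ltW t0) (IH _)); last lia.
  rewrite -ler_pdivrMr ?(LC_gt0 _ hM)// (LC_quotient_nondecreasing hM)//; lia.
have down d : t ^+ d * M p <= M (p + d)%N.
  elim: d => [|d IH]; first by rewrite addn0 mul1r.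
  rewrite addnS exprS -mulrA (le_trans (ler_wpM2l (ltW t0) IH))//.
  by rewrite -ler_pdivlMr ?(LC_gt0 _ hM)// (LC_quotient_nondecreasing hM)// leq_addr.
have [kp|/ltnW pk] := leqP k p.
  rewrite -[in leRHS](subnK kp) exprD mulrAC [in leRHS]mulrC ler_wpM2l ?exprn_ge0 ?(ltW t0)//.
  by have := up (p - k)%N; rewrite subnKC//; apply.
rewrite -[in leLHS](subnK pk) exprD mulrAC mulrC ler_wpM2l ?exprn_ge0 ?(ltW t0)//.
by have := down (k - p)%N; rewrite subnKC.
Qed.

(** * Bounds for the associated weight function *)

Lemma omega_ge M t p : LC M -> 0 < t -> ln (t ^+ p / M p) <= omega M t.
Proof.
move=> hM t0; rewrite /omega t0; apply: sup_ubound; last by exists p.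
by case: (has_sup_omega hM t0).
Qed.

Lemma omega_le M t x : 0 < t ->
  (forall p, ln (t ^+ p / M p) <= x) -> omega M t <= x.
Proof.
move=> t0 tx; rewrite /omega t0; apply: ge_sup.
  by exists (ln (t ^+ 0 / M 0%N)), 0%N.
by move=> _ [p _ <-].
Qed.

Lemma omega_ge0 M t : LC M -> 0 <= omega M t.
Proof.
move=> hM; have [t0|t0] := ltP 0 t; last by rewrite /omega ltNge t0.
apply: le_trans (omega_ge 0 hM t0).
by have [_ [-> _] _ _] := hM; rewrite expr0 divr1 ln1.
Qed.

Lemma ln_exprn x p : 0 < x -> ln (x ^+ p) = p%:R * ln x.
Proof. by move=> x0; rewrite lnXn// mulr_natl. Qed.

Lemma ln_term M t p : LC M -> 0 < t ->
  ln (t ^+ p / M p) = p%:R * ln t - ln (M p).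
Proof.
move=> hM t0; rewrite lnM ?posrE ?exprn_gt0 ?invr_gt0 ?(LC_gt0 _ hM)//.
by rewrite lnV ?posrE ?(LC_gt0 _ hM)// ln_exprn//.
Qed.

(** By [LC_quotient_max] the supremum at this point is attained at index [p]; [omega_ge] gives the
    reverse inequality. *)
Lemma omega_quotient M p : LC M ->
  omega M (M p.+1 / M p) <= ln ((M p.+1 / M p) ^+ p / M p).
Proof.
move=> hM; have t0 := LC_quotient_gt0 p hM.
apply: omega_le => // k; rewrite ler_ln ?posrE ?divr_gt0 ?exprn_gt0 ?(LC_gt0 _ hM)//.
exact: LC_quotient_max.
Qed.

(** * Clearing roots by taking powers *)

Lemma ler_root_pow (a b u d v : R) k p : (0 < k)%N -> (0 < p)%N ->
  0 <= a -> 0 <= b -> 0 <= u -> 0 <= d -> 0 <= v ->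
  (a * u `^ (p%:R^-1) <= b * d `^ (p%:R^-1) * v `^ ((k * p)%N%:R^-1)) =
  (a ^+ (k * p) * u ^+ k <= b ^+ (k * p) * d ^+ k * v).
Proof.
move=> k0 p0 a0 b0 u0 d0 v0.
have rootX (z : R) n : 0 <= z -> (0 < n)%N -> (z `^ (n%:R^-1)) ^+ n = z.
  move=> z0 n0; rewrite -powR_mulrn ?powR_ge0// -powRrM mulVf ?powRr1//.
  by rewrite pnatr_eq0 -lt0n.
have kp0 : (0 < k * p)%N by rewrite muln_gt0 k0.
rewrite -(ler_pXn2r kp0) ?nnegrE ?mulr_ge0 ?powR_ge0//.
have rootXM (z : R) : 0 <= z -> (z `^ (p%:R^-1)) ^+ (k * p) = z ^+ k.
  by move=> z0; rewrite mulnC exprM rootX.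
by rewrite !exprMn (rootX v)// !rootXM.
Qed.

(** * Comparison of [p!] with [p ^ p] *)

Lemma fact_le_expn p : (p`! <= p ^ p)%N.
Proof.
elim: p => // p IH; rewrite factS expnS leq_mul2l (leq_trans IH)//.
by case: p {IH} => // p; rewrite leq_exp2r.
Qed.

(** By induction: for [q > 0], passing from [q] to [q + 1] amounts to [(1 + 1/q) ^ q <= e], which is
    the [q]-th power of [1 + 1/q <= exp (1/q)]. *)
Lemma expn_le_fact p : (p ^ p)%N%:R <= expR 1 ^+ p * p`!%:R :> R.
Proof.
elim: p => [|p IH]; first by rewrite expr0 mul1r.
case: p => [|p] in IH *.
  by rewrite expr1 mulr1 (le_trans _ (expR_ge1Dx 1))// lerDl.
have p0 : 0 < p.+1%:R :> R by rewrite ltr0n.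
rewrite expnS factS exprS natrM (natrM _ p.+2) mulrCA ler_wpM2l//.
apply: (@le_trans _ _ (expR 1 * (p.+1 ^ p.+1)%N%:R)); last first.
  by rewrite -mulrA ler_wpM2l ?expR_ge0.
rewrite !natrX -ler_pdivrMr ?exprn_gt0// -expr_div_n.
have -> : expR 1 = expR (p.+1%:R^-1) ^+ p.+1 :> R.
  by rewrite -expRM_natl mulfV// gt_eqF.
rewrite lerXn2r ?nnegrE ?divr_ge0 ?expR_ge0//.
apply: le_trans (expR_ge1Dx _).
by rewrite -(natr1 p.+1) mulrDl mulfV ?gt_eqF// mul1r.
Qed.

(** * Passing between weight functions and power inequalities *)

(* Writing an index as [j] with [p := j %/ k], the hypothesis at [p] bounds the
   term of index [k * p]; passing to [j] costs a factor at most [(l%:R * t) ^+ k],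
   whose logarithm is absorbed by a second [k%:R * omega M (B * t)] through the
   term of index 1 of [omega M]. *)
Lemma omega_le_of_pow M N (k l : nat) (B D s t : R) : LC M -> LC N ->
  (0 < k)%N -> (0 < l)%N -> 1 <= B -> 1 <= D -> 0 < s -> s <= l%:R * t ->
  (forall p, (0 < p)%N ->
    l%:R ^+ (k * p) * M p ^+ k <= B ^+ (k * p) * D ^+ k * N (k * p)%N) ->
  omega N s <=
    k%:R * (2 * omega M (B * t) + (ln D + ln l%:R + ln (M 1%N))).
Proof.
move=> hM hN k0 l0 B1 D1 s0 st MN; apply: omega_le => // j.
have l0' : 0 < l%:R :> R by rewrite ltr0n.
have l1 : 1 <= l%:R :> R by rewrite ler1n.
have B0 : 0 < B by exact: lt_le_trans B1.
have D0 : 0 < D by exact: lt_le_trans D1.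
have t0 : 0 < t by rewrite -(pmulr_rgt0 _ l0'); exact: lt_le_trans st.
have lnM1 := ln_ge0 (LC_ge1 1 hM); have lnD := ln_ge0 D1.
have lnl := ln_ge0 l1; have lnB := ln_ge0 B1.
have w0 := omega_ge0 (B * t) hM.
have lnN := ln_ge0 (LC_ge1 j hN).
rewrite ln_term//.
(* For [s <= 1] every term is nonpositive, since [N j >= 1]. Otherwise [ln s >= 0], so [j] may be
   enlarged to [k * (p + 1)] in [js]. *)
have [s1|s1] := leP s 1.
  apply: (@le_trans _ _ 0); last by rewrite mulr_ge0// !addr_ge0// mulr_ge0.
  by rewrite subr_le0 (le_trans _ lnN)// mulr_ge0_le0// ln_le0.
pose p := (j %/ k)%N.
have kpj : (k * p <= j)%N by rewrite mulnC leq_trunc_div.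
have jkp : (j <= k * p.+1)%N by rewrite mulnC ltnW// ltn_ceil.
have lnst : ln s <= ln l%:R + ln t.
  by rewrite -lnM ?posrE// ler_ln ?posrE ?mulr_gt0.
have lns : 0 <= ln s by rewrite ln_ge0// ltW.
have js : j%:R * ln s <= k%:R * (p%:R + 1) * (ln l%:R + ln t).
  by rewrite natr1 -natrM ler_pM// ler_nat.
have Bt0 : 0 < B * t by rewrite mulr_gt0.
have := omega_ge p hM Bt0; have := omega_ge 1 hM Bt0.
rewrite !ln_term// lnM ?posrE// mul1r => w1 wp.
have NN : k%:R * (p%:R * ln l%:R + ln (M p)) <=
          k%:R * (p%:R * ln B + ln D) + ln (N j).
  apply: (@le_trans _ _
    (k%:R * (p%:R * ln B + ln D) + ln (N (k * p)%N))); last first.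
    by rewrite lerD2l ler_ln ?posrE ?(LC_gt0 _ hM) ?(LC_gt0 _ hN)// LC_nondecreasing.
  (* The hypothesis [MN] starts at [p = 1]; index 0 is covered by the normalization
     [M 0 = N 0 = 1]. *)
  have [->|p0] := posnP p.
    have [[_ [M0 _] _ _] [_ [N0 _] _ _]] := (hM, hN).
    by rewrite muln0 M0 N0 ln1 !mul0r !add0r addr0 mulr0 mulr_ge0.
  have := MN p p0.
  rewrite -ler_ln ?posrE ?mulr_gt0 ?exprn_gt0 ?(LC_gt0 _ hM) ?(LC_gt0 _ hN)//.
  rewrite !lnM ?posrE ?mulr_gt0 ?exprn_gt0 ?(LC_gt0 _ hM) ?(LC_gt0 _ hN)//.
  rewrite !ln_exprn ?(LC_gt0 _ hM) ?(LC_gt0 _ hN)//.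
  by rewrite natrM; lra.
(* The multiples [p%:R * ln l%:R] from [js] and [NN] cancel. The terms of index [p] and 1 of
   [omega M] absorb the rest, up to a constant independent of [p]. *)
have : k%:R * ((p%:R + 1) * (ln l%:R + ln t) - p%:R * ln l%:R - ln (M p)
          + p%:R * ln B + ln D) <=
   k%:R * (2 * omega M (B * t) + (ln D + ln l%:R + ln (M 1%N))).
  by rewrite ler_wpM2l//; lra.
move: js NN; lra.
Qed.

Lemma pow_of_omega M N (k l p : nat) (A C D : R) : LC M -> LC N ->
  (0 < l)%N -> 1 <= A -> 1 <= C ->
  (forall t, 0 <= t ->
    omega N (l%:R * C * t) <= k%:R * omega M (A * t) + D * k%:R) ->
  l%:R ^+ (k * p) * M p ^+ k <= A ^+ (k * p) * expR D ^+ k * N (k * p)%N.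
Proof.
move=> hM hN l0 A1 C1 MN.
have l0' : 0 < l%:R :> R by rewrite ltr0n.
have A0 : 0 < A by exact: lt_le_trans A1.
have C0 : 0 < C by exact: lt_le_trans C1.
have lnC := ln_ge0 C1.
have m0 := LC_quotient_gt0 p hM; have := omega_quotient p hM.
move: (_ / _) m0 => mu m0 wmu.
(* The choice [t = mu / A] makes the right-hand side evaluate [omega M] at [mu], where index [p] is
   maximal. *)
have t0 : 0 < l%:R * C * (mu / A) by rewrite !mulr_gt0 ?invr_gt0.
have := le_trans (omega_ge (k * p) hN t0) (MN _ (ltW (divr_gt0 m0 A0))).
rewrite (mulrC A) divfK ?gt_eqF// => /le_trans.
move=> /(_ _ (lerD (ler_wpM2l (ler0n _ k) wmu) (lexx _))).
rewrite !ln_term// !lnM ?posrE ?mulr_gt0 ?invr_gt0// lnV ?posrE// natrM => MNp.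
rewrite -ler_ln ?posrE ?mulr_gt0 ?exprn_gt0 ?(LC_gt0 _ hM) ?(LC_gt0 _ hN) ?expR_gt0//.
rewrite !lnM ?posrE ?mulr_gt0 ?exprn_gt0 ?(LC_gt0 _ hM) ?(LC_gt0 _ hN) ?expR_gt0//.
rewrite !ln_exprn ?(LC_gt0 _ hM) ?(LC_gt0 _ hN) ?expR_gt0// expRK natrM.
(* The factor [C ^+ (k * p)] gained on the left is at least 1 and is dropped. *)
have : 0 <= k%:R * p%:R * ln C by rewrite !mulr_ge0.
move: MNp; lra.
Qed.

(** * Passing between [M], [N] and their quotients by factorials *)

Lemma pow_fact M N (l C p : nat) (B D : R) : (0 < l)%N -> 0 <= B -> 0 <= D ->
  (forall q, 0 < N q) ->
  let k := (l * C)%N in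
  l%:R ^+ (k * p) * M p ^+ k <= B ^+ (k * p) * D ^+ k * N (k * p)%N ->
  (M p / p`!%:R) ^+ k <=
    (B * C%:R * expR 1) ^+ (k * p) * D ^+ k * (N (k * p)%N / (k * p)`!%:R).
Proof.
move=> l0 B0 D0 N0 k MN.
have f0 q : 0 < q`!%:R :> R by rewrite ltr0n fact_gt0.
rewrite mulrA ler_pdivlMr// expr_div_n mulrAC ler_pdivrMr ?exprn_gt0//.
rewrite -(ler_pM2l (x := l%:R ^+ (k * p))) ?exprn_gt0 ?ltr0n//.
rewrite mulrA (le_trans (ler_wpM2r (ltW (f0 _)) MN))//.
(* Split [(k p) ^ (k p)] along [k = l C], then use [p ^ p <= e ^ p p!]. The resulting power of [l]
   is the factor that separates (ii) from (iii). *)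
have : (k * p)`!%:R <= l%:R ^+ (k * p) * C%:R ^+ (k * p) *
                      expR 1 ^+ (k * p) * p`!%:R ^+ k :> R.
  apply: (@le_trans _ _ ((k * p) ^ (k * p))%N%:R).
    by rewrite ler_nat fact_le_expn.
  have kE : k%:R = l%:R * C%:R :> R by rewrite natrM.
  rewrite expnMn natrM natrX kE exprMn -[leRHS]mulrA ler_wpM2l//.
  rewrite mulnC expnM natrX exprM -exprMn.
  by rewrite lerXn2r ?nnegrE ?mulr_ge0 ?exprn_ge0 ?expR_ge0// expn_le_fact.
have X0 : 0 <= B ^+ (k * p) * D ^+ k * N (k * p)%N.
  by rewrite !mulr_ge0 ?exprn_ge0// ltW.
move=> /(ler_wpM2l X0) /le_trans; apply; rewrite !exprMn; lra.
Qed.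

Lemma fact_pow M N (l C p : nat) (A D : R) : (0 < l)%N -> (0 < C)%N ->
  0 <= A -> 0 <= D -> (forall q, 0 < N q) ->
  let k := (l * C)%N in
  (M p / p`!%:R) ^+ k <= A ^+ (k * p) * D ^+ k * (N (k * p)%N / (k * p)`!%:R) ->
  l%:R ^+ (k * p) * M p ^+ k <=
    (A * expR 1) ^+ (k * p) * D ^+ k * N (k * p)%N.
Proof.
move=> l0 C0 A0 D0 N0 k.
have f0 q : 0 < q`!%:R :> R by rewrite ltr0n fact_gt0.
rewrite mulrA ler_pdivlMr// expr_div_n mulrAC ler_pdivrMr ?exprn_gt0// => MN.
rewrite -(ler_pM2r (x := (k * p)`!%:R))// -[leLHS]mulrA.
rewrite (le_trans (ler_wpM2l _ MN)) ?exprn_ge0//.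
(* Here [p! <= p ^ p] bounds the left side by [(l p) ^ (k p)], and [l <= k] because [C >= 1]. *)
have : l%:R ^+ (k * p) * p`!%:R ^+ k <= expR 1 ^+ (k * p) * (k * p)`!%:R :> R.
  apply: le_trans (expn_le_fact _).
  rewrite -!natrX -natrM ler_nat (leq_trans (n := ((l * p) ^ (k * p))%N))//.
    rewrite expnMn leq_mul2l; apply/orP; right.
    by rewrite [in leqRHS]mulnC expnM leq_exp2r ?fact_le_expn// muln_gt0 l0.
  have [->|kp0] := posnP (k * p)%N; first by rewrite !expn0.
  by rewrite leq_exp2r// /k leq_mul2r leq_pmulr ?orbT.
have X0 : 0 <= A ^+ (k * p) * D ^+ k * N (k * p)%N.
  by rewrite !mulr_ge0 ?exprn_ge0// ltW.
move=> /(ler_wpM2l X0) H; rewrite exprMn; move: H; lra.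
Qed.

End weight_sequences.

(** * The cycle of implications and its constants *)

Theorem theorem5p1 (R : realType) (M N : nat -> R) (hM : LC M) (hN : LC N) :
  let m := fun p : nat => M p / p`!%:R in
  let n := fun p : nat => N p / p`!%:R in
  [<->
    exists A : R, 1 <= A /\ exists B : R, 1 <= B /\ exists C : R, 1 <= C /\
    forall l : R, 1 <= l -> exists D : R, 1 <= D /\
    forall t : R, 0 <= t ->
      omega N (l * C * t) <= B * l * omega M (A * t) + D * l;

    exists C : nat, (0 < C)%N /\ exists B : R, 1 <= B /\
    forall l : nat, (0 < l)%N -> exists D : R, 1 <= D /\
    forall p : nat, (0 < p)%N ->
      l%:R * M p `^ (p%:R^-1)
        <= B * D `^ (p%:R^-1) * N (l * C * p)%N `^ ((l * C * p)%N%:R^-1);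

    exists C : nat, (0 < C)%N /\ exists A : R, 1 <= A /\
    forall l : nat, (0 < l)%N -> exists D : R, 1 <= D /\
    forall p : nat, (0 < p)%N ->
      m p `^ (p%:R^-1)
        <= A * D `^ (p%:R^-1) * n (l * C * p)%N `^ ((l * C * p)%N%:R^-1) ].
Proof.
move=> m n.
have M0 p : 0 <= M p by rewrite ltW// LC_gt0.
have N0 p : 0 <= N p by rewrite ltW// LC_gt0.
have m0 p : 0 <= m p by rewrite divr_ge0.
have n0 p : 0 <= n p by rewrite divr_ge0.
have e1 : 1 <= expR 1 :> R by rewrite (le_trans _ (expR_ge1Dx 1))// lerDl.
tfae.
- move=> [A [A1 [B [B1 [C [C1 MN]]]]]].
  have B0 : 0 <= B by exact: le_trans B1.
  (* The integer [b >= B] becomes the constant [C] of (ii), so that [B * l <= k] with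
     [k = l * b]. *)
  pose b := (Num.truncn B).+1.
  have Bb : B <= b%:R by rewrite ltW// truncnS_gt.
  exists b; split=> //; exists A; split=> // l l0.
  have l1 : 1 <= l%:R :> R by rewrite ler1n.
  have [D [D1 {}MN]] := MN l%:R l1.
  have D0 : 0 <= D by exact: le_trans D1.
  exists (expR D); split=> [|p p0].
    by rewrite (le_trans _ (expR_ge1Dx _))// lerDl.
  rewrite ler_root_pow ?muln_gt0 ?l0 ?expR_ge0 ?(le_trans _ A1)//.
  apply: (pow_of_omega _ hM hN l0 A1 C1) => t t0.
  have w0 := omega_ge0 (A * t) hM.
  apply: le_trans (MN t t0) _; rewrite natrM lerD//.
    by rewrite ler_wpM2r// mulrC ler_wpM2l.
  by rewrite ler_wpM2l// ler_peMr// ler1n.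
- move=> [C [C0 [B [B1 MN]]]].
  have B0 : 0 <= B by exact: le_trans B1.
  have C1 : 1 <= C%:R :> R by rewrite ler1n.
  exists C; split=> //; exists (B * C%:R * expR 1); split=> [|l l0].
    by rewrite !mulr_ege1.
  have [D [D1 {}MN]] := MN l l0.
  have D0 : 0 <= D by exact: le_trans D1.
  exists D; split=> // p p0; rewrite -[leLHS]mul1r.
  rewrite ler_root_pow ?muln_gt0 ?l0 ?mulr_ge0 ?expR_ge0//.
  rewrite expr1n mul1r pow_fact// => [q|]; first exact: LC_gt0.
  by rewrite -ler_root_pow ?muln_gt0 ?l0// MN.
- move=> [C [C0 [A [A1 MN]]]].
  have A0 : 0 <= A by exact: le_trans A1.
  pose B := A * expR 1.
  have B1 : 1 <= B by rewrite mulr_ege1.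
  (* The way from (iii) to (i) goes through the power form of (ii). *)
  have {}MN l : (0 < l)%N -> exists D : R, 1 <= D /\ forall p, (0 < p)%N ->
      l%:R ^+ (l * C * p) * M p ^+ (l * C) <=
      B ^+ (l * C * p) * D ^+ (l * C) * N (l * C * p)%N.
    move=> l0; have [D [D1 {}MN]] := MN l l0.
    have D0 : 0 <= D by exact: le_trans D1.
    exists D; split=> // p p0; apply: fact_pow => // [q|]; first exact: LC_gt0.
    have := MN p p0; rewrite -[leLHS]mul1r.
    by rewrite ler_root_pow ?muln_gt0 ?l0// expr1n mul1r.
  (* One factor 2 comes from [omega_le_of_pow], the other from rounding [x] up to an integer
     [l <= x + 1 <= 2 * x]. *)
  exists B; split=> //; exists (4 * C%:R).
  have C1 : 1 <= C%:R :> R by rewrite ler1n.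
  split; first by lra.
  exists 1; split=> // x x1.
  have x0 : 0 <= x by exact: le_trans x1.
  pose l := (Num.truncn x).+1.
  have xl : x <= l%:R by rewrite ltW// truncnS_gt.
  have lx : l%:R <= 2 * x.
    by have := truncn_le x; rewrite x0 -[l%:R]natr1; lra.
  have [D [D1 {}MN]] := MN l isT.
  set K := ln D + ln l%:R + ln (M 1%N).
  have K0 : 0 <= K by rewrite !addr_ge0 ?ln_ge0 ?ler1n ?(LC_ge1 _ hM).
  exists (1 + 2 * C%:R * K); split=> [|t]; first by rewrite lerDl !mulr_ge0.
  (* At [t = 0] both weight functions vanish by definition; [omega_le_of_pow] requires a positive
     argument. *)
  rewrite le_eqVlt => /predU1P[<-|t0].
    rewrite !mulr0 /omega ltxx mulr0 add0r !mulr_ge0// addr_ge0//.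
    by rewrite !mulr_ge0.
  have w0 := omega_ge0 (B * t) hM.
  have s0 : 0 < x * 1 * t by rewrite mulr1 mulr_gt0// (lt_le_trans _ x1).
  have sl : x * 1 * t <= l%:R * t by rewrite mulr1 ler_pM2r.
  have k0 : (0 < l * C)%N by rewrite muln_gt0.
  apply: le_trans (omega_le_of_pow hM hN k0 (ltn0Sn _) B1 D1 s0 sl MN) _.
  rewrite -/K natrM.
  apply: (@le_trans _ _ (2 * x * C%:R * (2 * omega M (B * t) + K))).
    by apply: ler_wpM2r; [lra|exact: ler_wpM2r].
  lra.
Qed.
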